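(* Let $M\in\mathbb{R}^{m\times n}$ with $M=P-N$, $P,N\ge \mathbf 0$. For every constant $\epsilon>0$, $\|M-VW\|_F$ is nonincreasing under $$V\leftarrow\max\Big(\epsilon,\,V\circ\frac{[PW^T]}{[VWW^T+NW^T]}\Big),\qquad W\leftarrow\max\Big(\epsilon,\,W\circ\frac{[V^TP]}{[V^TVW+V^TN]}\Big)$$ for any $(V,W)\ge\epsilon$, with $V\in\mathbb{R}^{m\times r}$, $W\in\mathbb{R}^{r\times n}$. Moreover, every limit point of the algorithm that alternately applies these two updates is a stationary point of the optimization problem $$\min_{V\ge\epsilon,\;W\ge\epsilon}\ \|M-VW\|_F^2 .$$
   Context: $\circ$ is the component-wise product, $\frac{[A]}{[B]}$ is component-wise division, and $\max(\epsilon,\cdot)$ and the inequalities $\ge \epsilon$ are entrywise. ''Nonincreasing'' means that applying the first update ($W$ fixed) or the second update ($V$ fixed) does not increase $\|M-VW\|_F$. The algorithm starts from some $(V^0,W^0)\ge\epsilon$ and generates a sequence $\{(V^k,W^k)\}$ by alternating the two updates; a limit point is the limit of a convergent subsequence. A stationary point is a point satisfying the first-order (KKT) conditions of the problem: with $f(V,W)=\|M-VW\|_F^2$, one has $V\ge\epsilon$, $\nabla_Vf\ge\mathbf 0$, $(V_{ik}-\epsilon)(\nabla_Vf)_{ik}=0$ for all $i,k$, and likewise for $W$. *)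

(* Defs.v *)
(* MathComp / MathComp-Analysis *)
From HB Require Import structures.
From mathcomp Require Import all_boot all_order all_algebra.
From mathcomp Require Import all_classical all_reals all_analysis.

Set Implicit Arguments.
Unset Strict Implicit.
Unset Printing Implicit Defensive.
Import Order.TTheory GRing.Theory Num.Theory.
Import numFieldNormedType.Exports.
Local Open Scope classical_set_scope.
Local Open Scope ring_scope.

(* The library norm `|A| on matrices is the max norm, hence this definition. *)
Definition frobenius (R : realType) (m n : nat) (A : 'M[R]_(m, n)) : R :=
  Num.sqrt (\sum_(i < m) \sum_(j < n) A i j ^+ 2).

Definition mx_ge (R : realType) (m n : nat) (c : R) (A : 'M[R]_(m, n)) : Prop :=
  forall i j, c <= A i j.

Definition mx_max (R : realType) (m n : nat) (c : R) (A : 'M[R]_(m, n)) :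
    'M[R]_(m, n) :=
  map_mx (Num.max c) A.

Definition hadamard (R : realType) (m n : nat) (A B : 'M[R]_(m, n)) :
    'M[R]_(m, n) :=
  map2_mx *%R A B.

Definition mx_div (R : realType) (m n : nat) (A B : 'M[R]_(m, n)) :
    'M[R]_(m, n) :=
  map2_mx (fun a b => a / b) A B.

Definition updateV (R : realType) (m n r : nat) (P N : 'M[R]_(m, n)) (eps : R)
    (V : 'M[R]_(m, r)) (W : 'M[R]_(r, n)) : 'M[R]_(m, r) :=
  mx_max eps
    (hadamard V (mx_div (P *m W^T) (V *m W *m W^T + N *m W^T))).

Definition updateW (R : realType) (m n r : nat) (P N : 'M[R]_(m, n)) (eps : R)
    (V : 'M[R]_(m, r)) (W : 'M[R]_(r, n)) : 'M[R]_(r, n) :=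
  mx_max eps
    (hadamard W (mx_div (V^T *m P) (V^T *m V *m W + V^T *m N))).

(* One full sweep: W is updated using the V that has just been computed. *)
Definition sweep (R : realType) (m n r : nat) (P N : 'M[R]_(m, n)) (eps : R)
    (VW : 'M[R]_(m, r) * 'M[R]_(r, n)) : 'M[R]_(m, r) * 'M[R]_(r, n) :=
  let V := updateV P N eps VW.1 VW.2 in (V, updateW P N eps V VW.2).

Definition iterates (R : realType) (m n r : nat) (P N : 'M[R]_(m, n)) (eps : R)
    (VW0 : 'M[R]_(m, r) * 'M[R]_(r, n)) (k : nat) :
    'M[R]_(m, r) * 'M[R]_(r, n) :=
  iter k (sweep P N eps) VW0.

Definition subseq_limit (T : topologicalType) (u : nat -> T) (l : T) : Prop :=
  exists phi : nat -> nat,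
    {homo phi : i j / (i < j)%N} /\ (u \o phi) @ \oo --> l.

Definition objective (R : realType) (m n r : nat) (M : 'M[R]_(m, n))
    (V : 'M[R]_(m, r)) (W : 'M[R]_(r, n)) : R :=
  frobenius (M - V *m W) ^+ 2.

Definition gradient_mx (R : realType) (m n : nat) (f : 'M[R]_(m, n) -> R)
    (X : 'M[R]_(m, n)) : 'M[R]_(m, n) :=
  \matrix_(i, j) 'D_(delta_mx i j) f X.

Definition kkt_block (R : realType) (m n : nat) (eps : R)
    (X G : 'M[R]_(m, n)) : Prop :=
  [/\ mx_ge eps X, mx_ge 0 G & forall i j, (X i j - eps) * G i j = 0].

Definition stationary_point (R : realType) (m n r : nat) (M : 'M[R]_(m, n))
    (eps : R) (V : 'M[R]_(m, r)) (W : 'M[R]_(r, n)) : Prop :=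
  kkt_block eps V (gradient_mx (fun V' => objective M V' W) V) /\
  kkt_block eps W (gradient_mx (fun W' => objective M V W') W).

(* Main.v *)
(* Let Q = V W W^T + N W^T. At V, the function f = ||P - N - V W||_F^2 is
   majorized by the separable quadratic with curvatures Q_ik / V_ik, because
   ||H W||_F^2 <= sum_ik (V W W^T)_ik / V_ik * H_ik^2 (Cauchy-Schwarz), and the
   update of V is the minimizer of this quadratic over V >= eps. As
   Q_ik / V_ik >= n eps^2, one update decreases f by at least
   n eps^2 ||V1 - V||_F^2. Hence f converges along the iterates and their
   increments tend to 0, so that the optimality conditions of the quadratic
   subproblem, which are polynomial in (V, W, V1), pass to the limit along the
   subsequence with V1 and V having the same limit: these are the KKT
   conditions. The update of W is the update of V for the transposed problem. *)
Require Import Defs.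
From HB Require Import structures.
From mathcomp Require Import all_boot all_order all_algebra.
From mathcomp Require Import ring.
From mathcomp Require Import all_classical all_reals all_analysis.
Import Order.TTheory GRing.Theory Num.Theory.
Import numFieldNormedType.Exports.
Local Open Scope classical_set_scope.
Local Open Scope ring_scope.
Set Implicit Arguments.
Unset Strict Implicit.

(** * Frobenius norm and second-order expansion of the objective *)

Lemma frobenius_ge0 (R : realType) (m n : nat) (A : 'M[R]_(m, n)) :
  0 <= frobenius A.
Proof. exact: sqrtr_ge0. Qed.

Lemma frobenius_sqr (R : realType) (m n : nat) (A : 'M[R]_(m, n)) :
  frobenius A ^+ 2 = \sum_i \sum_j A i j ^+ 2.
Proof.
by rewrite sqr_sqrtr// sumr_ge0// => i _; rewrite sumr_ge0// => j _; rewrite sqr_ge0.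
Qed.

Lemma frobenius_tr (R : realType) (m n : nat) (A : 'M[R]_(m, n)) :
  frobenius A^T = frobenius A.
Proof.
rewrite /frobenius exchange_big /=; congr Num.sqrt.
by apply: eq_bigr => i _; apply: eq_bigr => j _; rewrite mxE.
Qed.

Lemma entry_sqr_le_frobenius (R : realType) (m n : nat) (A : 'M[R]_(m, n)) i j :
  A i j ^+ 2 <= frobenius A ^+ 2.
Proof.
rewrite frobenius_sqr (bigD1 i)//= (bigD1 j)//= -addrA lerDl addr_ge0 ?sumr_ge0//.
  by move=> k _; rewrite sqr_ge0.
by move=> k _; rewrite sumr_ge0// => l _; rewrite sqr_ge0.
Qed.

(** Right multiplication by [W^T] is adjoint to right multiplication by [W] for the entrywise inner
    product. *)
Lemma sum_mul_mulmx (R : comNzRingType) (m n r : nat) (A : 'M[R]_(m, n))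
    (H : 'M[R]_(m, r)) (W : 'M[R]_(r, n)) :
  \sum_i \sum_j A i j * (H *m W) i j = \sum_i \sum_k H i k * (A *m W^T) i k.
Proof.
apply: eq_bigr => i _; under eq_bigr do rewrite mxE mulr_sumr.
rewrite exchange_big; apply: eq_bigr => k _; rewrite mxE mulr_sumr.
by apply: eq_bigr => j _; rewrite mxE mulrCA mulrA.
Qed.

Lemma objective_tr (R : realType) (m n r : nat) (M : 'M[R]_(m, n))
    (V : 'M[R]_(m, r)) (W : 'M[R]_(r, n)) :
  objective M^T W^T V^T = objective M V W.
Proof. by rewrite /objective -trmx_mul -linearB /= frobenius_tr. Qed.

(** The objective is quadratic in [V], so its Taylor expansion is exact. It serves both the descent
    estimate and the computation of the gradient. *)
Lemma objective_shift (R : realType) (m n r : nat) (M : 'M[R]_(m, n))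
    (V H : 'M[R]_(m, r)) (W : 'M[R]_(r, n)) :
  objective M (V + H) W = objective M V W
    + 2 * (\sum_i \sum_k H i k * ((V *m W - M) *m W^T) i k)
    + frobenius (H *m W) ^+ 2.
Proof.
rewrite /objective -sum_mul_mulmx !frobenius_sqr mulr_sumr -!big_split /=.
apply: eq_bigr => i _; rewrite mulr_sumr -!big_split /=.
by apply: eq_bigr => j _; rewrite mulmxDl !mxE; ring.
Qed.

(** * Separable quadratic majorant and descent for the update of [V] *)

(** The polynomial [U - 2 t T + t^2 S] is a sum of squares with nonnegative weights [w k / v k], and
    its value at the minimizer [t = T / S] gives the bound. If [S = 0], all [w k] vanish and so does
    [T]. *)
Lemma weighted_cauchy_schwarz (R : realFieldType) (r : nat) (h v w : 'I_r -> R) :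
  (forall k, 0 < v k) -> (forall k, 0 <= w k) ->
  (\sum_k h k * w k) ^+ 2 <=
  (\sum_k v k * w k) * (\sum_k h k ^+ 2 * w k / v k).
Proof.
move=> v0 w0; set S := \sum_k v k * w k; set T := \sum_k h k * w k.
set U := (X in _ <= _ * X).
have S0 : 0 <= S by apply: sumr_ge0 => k _; rewrite mulr_ge0// ltW.
have E t : 0 <= U - 2 * t * T + t ^+ 2 * S.
  have -> : U - 2 * t * T + t ^+ 2 * S = \sum_k (h k - t * v k) ^+ 2 * (w k / v k).
    rewrite !mulr_sumr -sumrB -big_split /=; apply: eq_bigr => k _.
    by field; rewrite gt_eqF.
  by apply: sumr_ge0 => k _; rewrite mulr_ge0 ?sqr_ge0// divr_ge0// ltW.
move: S0; rewrite le_eqVlt => /orP[/eqP S0|S0]; last first.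
  have := E (T / S).
  have -> : U - 2 * (T / S) * T + (T / S) ^+ 2 * S = (S * U - T ^+ 2) / S.
    by field; rewrite gt_eqF.
  by rewrite pmulr_lge0 ?invr_gt0// subr_ge0.
suff -> : T = 0 by rewrite -S0 mul0r expr0n.
apply: big1 => k _; have /eqP := esym S0.
rewrite psumr_eq0; last by move=> i _; rewrite mulr_ge0// ltW.
by move/allP/(_ k (mem_index_enum _)); rewrite mulf_eq0 gt_eqF//= => /eqP->; rewrite mulr0.
Qed.

(** Weighted Cauchy-Schwarz is applied to each entry of [H *m W], with row [i] of [V] and column [j]
    of [W]; summing over [j] produces the curvatures. *)
Lemma frobenius_mul_le (R : realType) (m n r : nat) (V H : 'M[R]_(m, r))
    (W : 'M[R]_(r, n)) :
  (forall i k, 0 < V i k) -> (forall k j, 0 <= W k j) ->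
  frobenius (H *m W) ^+ 2 <=
  \sum_i \sum_k (V *m W *m W^T) i k / V i k * H i k ^+ 2.
Proof.
move=> V0 W0; rewrite frobenius_sqr; apply: ler_sum => i _.
apply: (@le_trans _ _ (\sum_j (V *m W) i j * \sum_k H i k ^+ 2 * W k j / V i k)).
  by apply: ler_sum => j _; rewrite !mxE; exact: weighted_cauchy_schwarz.
under eq_bigr do rewrite mulr_sumr.
rewrite exchange_big /=; apply: ler_sum => k _.
rewrite [(V *m W *m _) i k]mxE !mulr_suml; apply: ler_sum => j _.
by rewrite [W^T _ _]mxE le_eqVlt; apply/orP; left; apply/eqP; ring.
Qed.

(* The conclusion is the optimality condition over [eps, +oo[ of the
   quadratic with minimizer v * (p / q); unlike the update itself it is
   polynomial, hence stable under limits. *)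
Lemma max_step (R : realFieldType) (eps v p q : R) :
  0 <= q -> (q = 0 -> p = 0) ->
  let v1 := Num.max eps (v * (p / q)) in
  0 <= v1 * q - v * p /\ (v1 - eps) * (v1 * q - v * p) = 0.
Proof.
move=> q0 qp /=; have [q_eq0|q_neq0] := eqVneq q 0.
  by rewrite q_eq0 qp// !mulr0 subr0 mulr0.
have qgt0 : 0 < q by rewrite lt_def q_neq0.
have -> : v * p = v * (p / q) * q by rewrite -mulrA divfK.
rewrite -mulrBl; split.
  by rewrite mulr_ge0// subr_ge0 le_max lexx orbT.
by case: leP => _; rewrite subrr ?mul0r ?mulr0.
Qed.

(** Half the gradient in [V] is the denominator of the update minus its numerator. *)
Lemma gradientE (R : realType) (m n r : nat) (P N : 'M[R]_(m, n))
    (V : 'M[R]_(m, r)) (W : 'M[R]_(r, n)) :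
  (V *m W - (P - N)) *m W^T = V *m W *m W^T + N *m W^T - P *m W^T.
Proof. by rewrite opprB addrA mulmxBl mulmxDl. Qed.

(** The first bound drops [N *m W^T]. For the second, keeping only the index [k] in [(V *m W) i j]
    leaves [n] terms [V i k * W k j ^+ 2], each at least [V i k * eps ^+ 2]. *)
Lemma denominator_ge (R : realType) (m n r : nat) (N : 'M[R]_(m, n)) (eps : R)
    (V : 'M[R]_(m, r)) (W : 'M[R]_(r, n)) i k :
  mx_ge 0 N -> 0 < eps -> mx_ge eps V -> mx_ge eps W ->
  (V *m W *m W^T) i k <= (V *m W *m W^T + N *m W^T) i k /\
  n%:R * eps ^+ 2 <= (V *m W *m W^T + N *m W^T) i k / V i k.
Proof.
move=> hN e0 hV hW.
have W0 l j : 0 <= W l j by exact: le_trans (ltW e0) (hW l j).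
have V0 l j : 0 < V l j by exact: lt_le_trans e0 (hV l j).
have NW0 : 0 <= (N *m W^T) i k.
  by rewrite mxE; apply: sumr_ge0 => j _; rewrite mxE mulr_ge0.
have le1 : (V *m W *m W^T) i k <= (V *m W *m W^T + N *m W^T) i k.
  by rewrite [leRHS]mxE lerDl.
split=> //; rewrite ler_pdivlMr//; apply: le_trans le1.
rewrite mxE -[in leLHS](card_ord n) -mulrA mulr_natl -sumr_const.
apply: ler_sum => j _; rewrite [W^T _ _]mxE [(V *m W) i j]mxE (bigD1 k)//=.
apply: (@le_trans _ _ (V i k * W k j * W k j)).
  rewrite mulrC -mulrA ler_wpM2l ?(ltW (V0 _ _))// -expr2.
  by rewrite ler_sqr ?nnegrE// ltW.
rewrite ler_wpM2r// lerDl sumr_ge0// => l _.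
by rewrite mulr_ge0// ltW.
Qed.

Lemma updateV_ge (R : realType) (m n r : nat) (P N : 'M[R]_(m, n)) (eps : R)
    (V : 'M[R]_(m, r)) (W : 'M[R]_(r, n)) : mx_ge eps (updateV P N eps V W).
Proof. by move=> i k; rewrite mxE le_max lexx. Qed.

Lemma updateV_optimal (R : realType) (m n r : nat) (P N : 'M[R]_(m, n)) (eps : R)
    (V : 'M[R]_(m, r)) (W : 'M[R]_(r, n)) i k :
  mx_ge 0 N -> 0 < eps -> mx_ge eps V -> mx_ge eps W ->
  let V1 := updateV P N eps V W in
  let Q := V *m W *m W^T + N *m W^T in
  0 <= V1 i k * Q i k - V i k * (P *m W^T) i k /\
  (V1 i k - eps) * (V1 i k * Q i k - V i k * (P *m W^T) i k) = 0.
Proof.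
move=> hN e0 hV hW V1 Q.
have [_ /= geQ] := denominator_ge i k hN e0 hV hW.
have V0 : 0 < V i k by exact: lt_le_trans e0 (hV i k).
have Q0 : 0 <= Q i k.
  suff : 0 <= Q i k / V i k by rewrite pmulr_lge0// invr_gt0.
  by apply: le_trans geQ; rewrite mulr_ge0// sqr_ge0.
have -> : V1 i k = Num.max eps (V i k * ((P *m W^T) i k / Q i k)).
  by rewrite 2!mxE; congr (Num.max _ (_ * _)); rewrite mxE.
apply: max_step => // Qik0.
(* A zero denominator forces [n = 0], and then the numerator is an empty sum. *)
move: geQ; rewrite -/Q Qik0 mul0r pmulr_lle0 ?exprn_gt0//.
case: n => [|n] in P N W hN hW V1 Q Q0 Qik0 *; first by rewrite mxE big_ord0.
by rewrite lern0.
Qed.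

Lemma updateV_descent (R : realType) (m n r : nat) (P N : 'M[R]_(m, n))
    (eps : R) (V : 'M[R]_(m, r)) (W : 'M[R]_(r, n)) :
  mx_ge 0 N -> 0 < eps -> mx_ge eps V -> mx_ge eps W ->
  objective (P - N) (updateV P N eps V W) W
    + n%:R * eps ^+ 2 * frobenius (updateV P N eps V W - V) ^+ 2
    <= objective (P - N) V W.
Proof.
move=> hN e0 hV hW; set V1 := updateV P N eps V W.
have W0 l j : 0 <= W l j by exact: le_trans (ltW e0) (hW l j).
have V0 l j : 0 < V l j by exact: lt_le_trans e0 (hV l j).
rewrite -[in objective _ V1 _](subrKC V V1) objective_shift -2!addrA gerDl.
set H := V1 - V.
apply: (@le_trans _ _ (2 * (\sum_i \sum_k H i k * ((V *m W - (P - N)) *m W^T) i k)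
   + (\sum_i \sum_k (V *m W *m W^T) i k / V i k * H i k ^+ 2
      + n%:R * eps ^+ 2 * frobenius H ^+ 2))).
  by rewrite lerD2l lerD2r frobenius_mul_le.
(* The majorant is separable, so it suffices to bound each entry. *)
rewrite frobenius_sqr !mulr_sumr -!big_split /= -oppr_ge0 -sumrN sumr_ge0// => i _.
rewrite !mulr_sumr -!big_split /= -sumrN sumr_ge0// => k _; rewrite oppr_ge0.
have [] := denominator_ge i k hN e0 hV hW.
have [] := updateV_optimal P i k hN e0 hV hW; rewrite -/V1 /=.
rewrite gradientE [(_ - P *m W^T) i k]mxE [(- (P *m W^T)) i k]mxE [H i k]mxE [(- V) i k]mxE.
set q := (V *m W *m W^T + N *m W^T) i k; set s := (V *m W *m W^T) i k.
set p := (P *m W^T) i k; move: (V0 i k) (hV i k).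
move: (V1 i k) (V i k) (n%:R * eps ^+ 2) => v1 v c v_gt0 ev ge0 eq0 sq cq.
have le1 : s / v <= q / v by rewrite ler_pM2r// invr_gt0.
(* Variational inequality for the minimizer [v1] tested at the feasible point [v]: complementarity
   kills the part with [v1 - eps]. *)
have le2 : (v1 - v) * (v1 * q - v * p) / v <= 0.
  rewrite pmulr_lle0 ?invr_gt0//.
  have -> : v1 - v = (v1 - eps) - (v - eps) by ring.
  by rewrite mulrBl eq0 sub0r oppr_le0 mulr_ge0// subr_ge0.
apply: (@le_trans _ _ (2 * ((v1 - v) * (v1 * q - v * p) / v))); last first.
  by rewrite mulr_ge0_le0.
(* The curvature [q / v] occurs twice: one copy dominates [s / v], the other pays for the decrease
   constant [c]. *)
have -> : 2 * ((v1 - v) * (v1 * q - v * p) / v) =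
    2 * ((v1 - v) * (q - p)) + (q / v * (v1 - v) ^+ 2 + q / v * (v1 - v) ^+ 2).
  by field; rewrite gt_eqF.
by rewrite lerD2l lerD// ler_wpM2r// sqr_ge0.
Qed.

(** * Transposition: from the update of [V] to that of [W] *)

Lemma updateW_tr (R : realType) (m n r : nat) (P N : 'M[R]_(m, n)) (eps : R)
    (V : 'M[R]_(m, r)) (W : 'M[R]_(r, n)) :
  (updateW P N eps V W)^T = updateV P^T N^T eps W^T V^T.
Proof.
rewrite /updateW /updateV /mx_max /hadamard /mx_div map_trmx !map2_trmx.
by rewrite !trmx_mul !trmxK mulmxA.
Qed.

Lemma mx_ge_tr (R : realType) (m n : nat) (c : R) (A : 'M[R]_(m, n)) :
  mx_ge c A -> mx_ge c A^T.
Proof. by move=> hA i j; rewrite mxE. Qed.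

Lemma updateW_ge (R : realType) (m n r : nat) (P N : 'M[R]_(m, n)) (eps : R)
    (V : 'M[R]_(m, r)) (W : 'M[R]_(r, n)) : mx_ge eps (updateW P N eps V W).
Proof. by move=> i k; rewrite mxE le_max lexx. Qed.

Lemma updateW_descent (R : realType) (m n r : nat) (P N : 'M[R]_(m, n))
    (eps : R) (V : 'M[R]_(m, r)) (W : 'M[R]_(r, n)) :
  mx_ge 0 N -> 0 < eps -> mx_ge eps V -> mx_ge eps W ->
  objective (P - N) V (updateW P N eps V W)
    + m%:R * eps ^+ 2 * frobenius (updateW P N eps V W - W) ^+ 2
    <= objective (P - N) V W.
Proof.
move=> hN e0 hV hW.
have := updateV_descent P^T (mx_ge_tr hN) e0 (mx_ge_tr hW) (mx_ge_tr hV).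
by rewrite -updateW_tr -!linearB /= frobenius_tr !objective_tr.
Qed.

Lemma frobenius_le_objective (R : realType) (m n r : nat) (M : 'M[R]_(m, n))
    (V V' : 'M[R]_(m, r)) (W W' : 'M[R]_(r, n)) :
  objective M V W <= objective M V' W' ->
  frobenius (M - V *m W) <= frobenius (M - V' *m W').
Proof. by rewrite ler_sqr ?nnegrE ?frobenius_ge0. Qed.

(** * Gradients of the objective *)

(** For [h != 0] the difference quotient equals [a + h * b], which tends to [a]. *)
Lemma derive_quadratic (R : realType) (m n : nat) (f : 'M[R]_(m, n) -> R)
    (X D : 'M[R]_(m, n)) (a b : R) :
  (forall h, f (X + h *: D) = f X + h * a + h ^+ 2 * b) -> 'D_D f X = a.
Proof.
move=> hf; rewrite /derive; apply: cvg_lim => //.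
have : (fun h : R => a + h * b) @ 0^' --> a.
  rewrite -[X in _ --> X]addr0 -[X in _ --> _ + X](mul0r b).
  apply: cvg_within_filter; apply: cvgD; first exact: cvg_cst.
  by apply: cvgM; [exact: cvg_id|exact: cvg_cst].
apply: cvg_trans; apply: near_eq_cvg; near=> h.
have h0 : h != 0 by near: h; exact: nbhs_dnbhs_neq.
rewrite /= [_ *: D + X]addrC hf.
have -> : f X + h * a + h ^+ 2 * b - f X = h * (a + h * b) by ring.
by rewrite [RHS]mulKf.
Unshelve. all: by end_near. Qed.

Lemma gradient_objectiveV (R : realType) (m n r : nat) (M : 'M[R]_(m, n))
    (V : 'M[R]_(m, r)) (W : 'M[R]_(r, n)) :
  gradient_mx (fun V' => objective M V' W) V = 2 *: ((V *m W - M) *m W^T).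
Proof.
apply/matrixP => i k; rewrite mxE [RHS]mxE.
apply: (@derive_quadratic _ _ _ _ _ _ _ (frobenius (delta_mx i k *m W) ^+ 2)) => h.
rewrite objective_shift -scalemxAl; congr (_ + _ + _); last first.
  rewrite !frobenius_sqr mulr_sumr; apply: eq_bigr => i' _.
  by rewrite mulr_sumr; apply: eq_bigr => j _; rewrite mxE exprMn.
(* Pairing with [h *: delta_mx i k] leaves only the entry [(i, k)] of the double sum. *)
rewrite mulrCA; congr (2 * _); move: (_ *m W^T) => G; rewrite (bigD1 i)//= (bigD1 k)//= !mxE !eqxx mulr1.
rewrite big1 ?addr0 => [|k' /negPf k'k]; last by  rewrite !mxE k'k andbF mulr0 mul0r.
rewrite big1 ?addr0// => i' /negPf i'i.
by rewrite big1// => k' _; rewrite !mxE i'i mulr0 mul0r.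
Qed.

(** No differentiability is involved: the two difference quotients are the same function of [h]. *)
Lemma gradient_mx_tr (R : realType) (m n : nat) (f : 'M[R]_(m, n) -> R)
    (X : 'M[R]_(m, n)) :
  gradient_mx (fun Y => f Y^T) X^T = (gradient_mx f X)^T.
Proof.
apply/matrixP => i j; rewrite !mxE /derive; congr (lim _).
apply: (congr1 (fun g : R -> R^o => g @ (0 : R)^')).
apply/funext => h /=; rewrite trmxK.
suff -> : (h *: delta_mx i j + X^T)^T = h *: delta_mx j i + X by [].
by apply/matrixP => a b; rewrite !mxE andbC.
Qed.

Lemma kkt_block_tr (R : realType) (m n : nat) (eps : R) (X G : 'M[R]_(m, n)) :
  kkt_block eps X^T G^T -> kkt_block eps X G.
Proof.
by case=> h1 h2 h3; split=> i j; [have := h1 j i|have := h2 j i|have := h3 j i];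
  rewrite !mxE.
Qed.

(** * Passage to the limit in the optimality conditions *)

Lemma cvg_mulmx_entry (R : realType) (m n p : nat) (A : nat -> 'M[R]_(m, n))
    (B : nat -> 'M[R]_(n, p)) (a : 'M[R]_(m, n)) (b : 'M[R]_(n, p)) :
  (forall i j, A k i j @[k --> \oo] --> a i j) ->
  (forall i j, B k i j @[k --> \oo] --> b i j) ->
  forall i j, (A k *m B k) i j @[k --> \oo] --> (a *m b) i j.
Proof.
move=> hA hB i j; rewrite mxE; under eq_cvg do rewrite mxE.
by apply: cvg_big => [|l _]; [exact: add_continuous|exact: cvgM].
Qed.

(* For n = 0 the gradient vanishes, but descent gives no control on the
   increments of V; hence the guard on the last hypothesis. *)
Lemma kkt_block_limit (R : realType) (m n r : nat) (P N : 'M[R]_(m, n))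
    (eps : R) (Vk : nat -> 'M[R]_(m, r)) (Wk : nat -> 'M[R]_(r, n))
    (V : 'M[R]_(m, r)) (W : 'M[R]_(r, n)) :
  mx_ge 0 N -> 0 < eps ->
  (forall k, mx_ge eps (Vk k)) -> (forall k, mx_ge eps (Wk k)) ->
  (forall i j, Vk k i j @[k --> \oo] --> V i j) ->
  (forall i j, Wk k i j @[k --> \oo] --> W i j) ->
  ((0 < n)%N -> forall i j, updateV P N eps (Vk k) (Wk k) i j @[k --> \oo] --> V i j) ->
  kkt_block eps V (gradient_mx (fun V' => objective (P - N) V' W) V).
Proof.
move=> hN e0 gV gW cV cW cU.
have geV : mx_ge eps V.
  move=> i j; have <- := cvg_lim (@Rhausdorff R) (cV i j).
  by apply: limr_ge; [apply/cvg_ex; exists (V i j)|apply: nearW => k; exact: gV].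
rewrite gradient_objectiveV gradientE.
(* With the old and new [V] having the same limit, the conditions of the quadratic subproblem carry
   a factor [V i k]; it is at least [eps], hence can be cancelled. *)
suff main i k : let G := ((V *m W *m W^T + N *m W^T) i k - (P *m W^T) i k) in
    0 <= V i k * G /\ (V i k - eps) * (V i k * G) = 0.
  have V0 i k : 0 < V i k by exact: lt_le_trans e0 (geV i k).
  split=> // i k; have [] := main i k => /=; rewrite !mxE.
    by rewrite pmulr_rge0// => ? _; rewrite mulr_ge0.
  by move=> _ /eqP; rewrite mulrCA mulf_eq0 gt_eqF//= => /eqP G0; rewrite mulrCA G0 mulr0.
(* For [n = 0] all sums in [G] are empty; for [n > 0] the guard of [cU] is met. *)
case: n => [|n] in P N Wk W hN gW cW cU *.
  by rewrite /= !mxE !big_ord0 !addr0 subr0 !mulr0.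
have cWt i' j' : (Wk k)^T i' j' @[k --> \oo] --> W^T i' j'.
  by rewrite mxE; under eq_cvg do rewrite mxE; exact: cW.
have cc (A : 'M[R]_(m, n.+1)) i' j' : A i' j' @[k --> \oo] --> A i' j'.
  exact: cvg_cst.
have cP := @cvg_mulmx_entry _ _ _ _ _ _ _ _ (cc P) cWt i k.
have cQ := [elaborate cvgD
  (@cvg_mulmx_entry _ _ _ _ _ _ _ _ (@cvg_mulmx_entry _ _ _ _ _ _ _ _ cV cW) cWt i k)
  (@cvg_mulmx_entry _ _ _ _ _ _ _ _ (cc N) cWt i k)].
have cE := [elaborate cvgB (cvgM (cU isT i k) cQ) (cvgM (cV i k) cP)].
have cF := [elaborate cvgM (cvgB (cU isT i k) (cvg_cst eps)) cE].
have opt l := updateV_optimal P i k hN e0 (gV l) (gW l).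
rewrite /= mxE mulrBr; split.
  rewrite -(cvg_lim (@Rhausdorff R) cE).
  apply: limr_ge; first by apply/cvg_ex; eexists; exact: cE.
  apply: nearW => l; by have [+ _] := opt l; rewrite /= [X in _ * X - _]mxE.
rewrite -(cvg_lim (@Rhausdorff R) cF); apply: cvg_lim => //.
apply: cvg_near_cst; apply: nearW => l.
by have [_] := opt l; rewrite /= [X in _ * (_ * X - _)]mxE.
Qed.

(** * Vanishing increments of the iterates *)

(** As [d] is nonincreasing and bounded below, it converges, so [d k - d k.+1] tends to 0; [u] is
    squeezed by the square root of [c^-1] times this gap. *)
Lemma steps_vanish (R : realType) (d u : nat -> R) (c : R) :
  0 < c -> (forall k, 0 <= d k) -> (forall k, d k.+1 + c * u k ^+ 2 <= d k) ->
  u @ \oo --> 0.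
Proof.
move=> c0 d0 hd.
have dd k : d k.+1 <= d k.
  by apply: le_trans (hd k); rewrite lerDl mulr_ge0 ?sqr_ge0// ltW.
have cd : cvgn d.
  apply: nonincreasing_is_cvgn; first exact/nonincreasing_seqP.
  by exists 0 => _ [k _ <-].
have cd1 : d k.+1 @[k --> \oo] --> limn d by rewrite (cvg_shiftS d).
have cs : Num.sqrt (c^-1 * (d k - d k.+1)) @[k --> \oo] --> 0.
  rewrite -[X in _ --> X](sqrtr0 R) -[X in _ --> Num.sqrt X](mulr0 c^-1) -(subrr (limn d)).
  apply: continuous_cvg; first exact: sqrt_continuous.
  by apply: cvgM; [exact: cvg_cst|exact: cvgB].
apply/norm_cvg0P; apply: squeeze_cvgr (cvg_cst 0) cs; apply: nearW => k.
rewrite normr_ge0 -sqrtr_sqr ler_wsqrtr// ler_pdivlMl// lerBrDl.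
exact: hd.
Qed.

Lemma increasing_nat_cvg (phi : nat -> nat) :
  {homo phi : i j / (i < j)%N} -> phi @ \oo --> \oo.
Proof.
move=> hphi; have le_phi k : (k <= phi k)%N.
  by elim: k => // k IH; apply: leq_ltn_trans IH _; exact: hphi.
by move=> A [K _ KA]; exists K => // k /= Kk; apply/KA/(leq_trans Kk).
Qed.

Lemma iterates_ge (R : realType) (m n r : nat) (P N : 'M[R]_(m, n)) (eps : R)
    (V0 : 'M[R]_(m, r)) (W0 : 'M[R]_(r, n)) k :
  mx_ge eps V0 -> mx_ge eps W0 ->
  mx_ge eps (iterates P N eps (V0, W0) k).1 /\
  mx_ge eps (iterates P N eps (V0, W0) k).2.
Proof.
by case: k => [|k] //= _ _; split; [exact: updateV_ge|exact: updateW_ge].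
Qed.

Lemma weighted_sqr_ge0 (R : realDomainType) (l : nat) (eps x : R) :
  0 <= l%:R * eps ^+ 2 * x ^+ 2.
Proof. exact: mulr_ge0 (mulr_ge0 (ler0n _ _) (sqr_ge0 _)) (sqr_ge0 _). Qed.

(** The guards make the decrease constants [n%:R * eps ^+ 2] and [m%:R * eps ^+ 2] positive. For
    each factor, the decrease due to the other half-step is discarded. *)
Lemma iterates_increment (R : realType) (m n r : nat) (P N : 'M[R]_(m, n))
    (eps : R) (V0 : 'M[R]_(m, r)) (W0 : 'M[R]_(r, n)) :
  mx_ge 0 N -> 0 < eps -> mx_ge eps V0 -> mx_ge eps W0 ->
  let u := iterates P N eps (V0, W0) in
  ((0 < n)%N -> forall i j, (u k.+1).1 i j - (u k).1 i j @[k --> \oo] --> 0) /\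
  ((0 < m)%N -> forall i j, (u k.+1).2 i j - (u k).2 i j @[k --> \oo] --> 0).
Proof.
move=> hN e0 hV hW u.
pose d k := objective (P - N) (u k).1 (u k).2.
have d0 k : 0 <= d k by exact: sqr_ge0.
have uge k : mx_ge eps (u k).1 /\ mx_ge eps (u k).2 by exact: iterates_ge.
have dV k := updateV_descent P hN e0 (uge k).1 (uge k).2.
have dW k := updateW_descent P hN e0 (uge k.+1).1 (uge k).2.
split=> n0 i j.
  apply: (@steps_vanish _ d _ (n%:R * eps ^+ 2)) => //.
    by rewrite mulr_gt0 ?exprn_gt0// ltr0n.
  move=> k; apply: le_trans (dV k); apply: lerD.
    by apply: le_trans (dW k); rewrite lerDl weighted_sqr_ge0.
  rewrite ler_wpM2l ?(mulr_ge0 (ler0n _ _) (sqr_ge0 _))//.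
  by have := entry_sqr_le_frobenius ((u k.+1).1 - (u k).1) i j; rewrite !mxE.
apply: (@steps_vanish _ d _ (m%:R * eps ^+ 2)) => //.
  by rewrite mulr_gt0 ?exprn_gt0// ltr0n.
move=> k; apply: (@le_trans _ _ (objective (P - N) (u k.+1).1 (u k).2)); last first.
  by apply: le_trans (dV k); rewrite lerDl weighted_sqr_ge0.
apply: le_trans (dW k); rewrite lerD2l ler_wpM2l ?(mulr_ge0 (ler0n _ _) (sqr_ge0 _))//.
by have := entry_sqr_le_frobenius ((u k.+1).2 - (u k).2) i j; rewrite !mxE.
Qed.

(** * Monotonicity and stationarity of limit points *)

Unset Implicit Arguments.
Set Strict Implicit.

Theorem theorem9 (R : realType) (m n r : nat) (M P N : 'M[R]_(m, n)) (eps : R)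
    (hM : M = P - N) (hP : mx_ge 0 P) (hN : mx_ge 0 N) (heps : 0 < eps) :
  (forall (V : 'M[R]_(m, r)) (W : 'M[R]_(r, n)),
     mx_ge eps V -> mx_ge eps W ->
     frobenius (M - updateV P N eps V W *m W) <= frobenius (M - V *m W) /\
     frobenius (M - V *m updateW P N eps V W) <= frobenius (M - V *m W)) /\
  (forall (V0 : 'M[R]_(m, r)) (W0 : 'M[R]_(r, n)),
     mx_ge eps V0 -> mx_ge eps W0 ->
     forall (V : 'M[R]_(m, r)) (W : 'M[R]_(r, n)),
       subseq_limit (iterates P N eps (V0, W0)) (V, W) ->
       stationary_point M eps V W).
Proof.
rewrite hM; split=> [V W hV hW|V0 W0 hV0 hW0 V W [phi [phi_incr cu]]].
  split; apply: frobenius_le_objective.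
    apply: le_trans (updateV_descent P hN heps hV hW).
    by rewrite lerDl weighted_sqr_ge0.
  apply: le_trans (updateW_descent P hN heps hV hW).
  by rewrite lerDl weighted_sqr_ge0.
have [] := iterates_increment P hN heps hV0 hW0.
move: cu; set u := iterates P N eps (V0, W0) => cu /= dV dW.
have uge k : mx_ge eps (u k).1 /\ mx_ge eps (u k).2 by exact: iterates_ge.
have phioo := increasing_nat_cvg phi_incr.
have cV i j : (u (phi k)).1 i j @[k --> \oo] --> V i j.
  apply: (cvg_comp (fst \o (u \o phi)) (fun A : 'M[R]_(m, r) => A i j)).
    by apply: cvg_comp cu _; exact: cvg_fst.
  exact: coord_continuous.
have cW i j : (u (phi k)).2 i j @[k --> \oo] --> W i j.
  apply: (cvg_comp (snd \o (u \o phi)) (fun A : 'M[R]_(r, n) => A i j)).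
    by apply: cvg_comp cu _; exact: cvg_snd.
  exact: coord_continuous.
(* The increments vanish along the whole sequence, so the iterates just after those of the
   subsequence have the same limit, although [(phi k).+1] need not be a value of [phi]. *)
have cV1 : (0 < n)%N -> forall i j, (u (phi k).+1).1 i j @[k --> \oo] --> V i j.
  by move=> n0 i j; apply: cvg_sub0 (cV i j); exact: cvg_comp phioo (dV n0 i j).
have cW1 : (0 < m)%N -> forall i j, (u (phi k).+1).2 i j @[k --> \oo] --> W i j.
  by move=> m0 i j; apply: cvg_sub0 (cW i j); exact: cvg_comp phioo (dW m0 i j).
split.
  apply: (@kkt_block_limit _ _ _ _ P N eps (fun k => (u (phi k)).1)
            (fun k => (u (phi k)).2)) => // k; exact: (uge _).1 || exact: (uge _).2.
(* If [n = 0], [W] has no entries. Otherwise [cV1] is available; it is needed because the [W] update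
   reads the new [V]. *)
have [n0|n0] := posnP n; first by split=> i j; have := ltn_ord j; rewrite [X in (_ < X)%N]n0.
apply: kkt_block_tr; rewrite -gradient_mx_tr.
have -> : (fun Y => objective (P - N) V Y^T) = (fun Y => objective (P^T - N^T) Y V^T).
  by apply/funext => Y; rewrite -objective_tr trmxK linearB.
(* The index of the fixed factor is [(phi k).+1], so that one transposed update yields the transpose
   of [(u (phi k).+1).2]. *)
apply: (@kkt_block_limit _ _ _ _ P^T N^T eps (fun k => (u (phi k)).2^T)
  (fun k => (u (phi k).+1).1^T)) => //.
- exact: mx_ge_tr.
- by move=> k; apply: mx_ge_tr; exact: (uge _).2.
- by move=> k; apply: mx_ge_tr; exact: (uge _).1.
- by move=> i j; rewrite mxE; under eq_cvg do rewrite mxE; exact: cW.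
- by move=> i j; rewrite mxE; under eq_cvg do rewrite mxE; exact: cV1.
move=> m0 i j; rewrite mxE; under eq_cvg do rewrite -updateW_tr mxE.
exact: cW1.
Qed.
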